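(* Let $d$ be a positive integer and let $\Gamma$ be a simplicial complex on the vertex set $[n]$ which is a $d$-closure. Then $\Gamma$ is $d$-chordal if and only if $\Gamma$ is $d$-collapsible. In particular, a simplicial complex $\Sigma$ is chordal if and only if for all $d\geq 1$ the simplicial complex $\Delta_d(\Sigma)$ is $d$-collapsible.
   Context: A simplicial complex on $[n]=\{1,\dots,n\}$ is a set $\Gamma$ of subsets of $[n]$ (faces) closed under taking subsets; the void complex $\emptyset$ is allowed and singletons need not be faces. $\dim F=|F|-1$; facets are maximal faces. $d$-closure. Let $d\ge 1$. $\langle [n]\rangle^{[d-1]}$ denotes the complex of all subsets of $[n]$ with at most $d$ elements. The $d$-closure $\Delta_d(\Gamma)$ of $\Gamma$ is the simplicial complex on $[n]$ such that: its $d$-dimensional faces are exactly the $d$-dimensional faces of $\Gamma$; all subsets of $[n]$ with at most $d$ elements are faces; a subset of $[n]$ with more than $d+1$ elements is a face iff all its $(d+1)$-element subsets are faces of $\Gamma$. A complex is called a $d$-closure if it equals $\Delta_d(\Sigma)$ for some simplicial complex $\Sigma$ on $[n]$. Free and simplicial faces. A face $E$ of $\Gamma$ is free if it is contained in a unique facet (facets are free). If $\Gamma$ is a $d$-closure, a free face $E$ with $\dim E=d-1$ is called simplicial. Deletions. $\Gamma\setminus E=\{F\in\Gamma: E\not\subseteq F\}$; and $\Gamma\wr_E=\Gamma$ if $E\notin\Gamma$, $\Gamma\wr_E=(\Gamma\setminus E)\cup\{E\}$ if $E\in\Gamma$. (If $E$ is a simplicial face of a $d$-closure $\Gamma$, then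 $\Gamma\wr_E$ is again a $d$-closure.) Simplicial order. A simplicial order of a $d$-closure $\Gamma$ is a sequence $E_1,\dots,E_t$ of $(d-1)$-dimensional faces such that, for each $i\ge1$, $E_i$ is a simplicial face but not a facet of $\Gamma\wr_{E_1}\cdots\wr_{E_{i-1}}$, and $\Gamma\wr_{E_1}\cdots\wr_{E_t}=\langle[n]\rangle^{[d-1]}$. Chordality. $\Gamma$ is $d$-chordal if either $\Delta_d(\Gamma)=\langle[n]\rangle^{[d-1]}$ or $\Delta_d(\Gamma)$ admits a simplicial order. $\Gamma$ is chordal if it is $d$-chordal for every $d\ge1$. Collapsibility. If $E$ is a free face of $\Gamma$ with $\dim E<d$, replacing $\Gamma$ by $\Gamma\setminus E$ is an elementary $d$-collapsing. $\Gamma$ is $d$-collapsible if it can be reduced to the void complex $\emptyset$ by finitely many elementary $d$-collapsings. *)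

(* Defs.v *)
From mathcomp Require Import all_boot.
From Stdlib Require Import Relation_Operators.

Set Implicit Arguments.
Unset Strict Implicit.
Unset Printing Implicit Defensive.

(* The ground set [n] is 'I_n, and a complex is the set of its faces.  As
   dim F = |F| - 1 (so that the empty face has dimension -1), dimensions are
   expressed through cardinals: dim F = d - 1 reads #|F| = d, dim F = d reads
   #|F| = d.+1, and dim F < d reads #|F| <= d. *)
Section Complexes.

Variable n : nat.
Implicit Types (d : nat) (E F G : {set 'I_n}) (C : {set {set 'I_n}}).

(* The void complex set0 is included, and singletons need not be faces. *)
Definition simplicial_complex C : Prop :=
  forall F G, F \in C -> G \subset F -> G \in C.

Definition facet C F : bool := maxset [pred G : {set 'I_n} | G \in C] F.

(* <[n]>^[d-1] *)
Definition complete_skeleton d : {set {set 'I_n}} :=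
  [set F : {set 'I_n} | #|F| <= d].

Definition d_closure d C : {set {set 'I_n}} :=
  [set F : {set 'I_n} |
    [|| #|F| <= d,
        (#|F| == d.+1) && (F \in C)
      | (d.+1 < #|F|) &&
        [forall G : {set 'I_n},
           (G \subset F) && (#|G| == d.+1) ==> (G \in C)]]].

Definition is_d_closure d C : Prop :=
  exists2 D, simplicial_complex D & C = d_closure d D.

Definition free_face C E : Prop :=
  E \in C /\ exists! F, facet C F /\ E \subset F.

Definition simplicial_face d C E : Prop := free_face C E /\ #|E| = d.

Definition deletion C E : {set {set 'I_n}} := [set F in C | ~~ (E \subset F)].

(* The operation C wr_E: unlike in deletion, E itself stays a face. *)
Definition wr_deletion C E : {set {set 'I_n}} :=
  if E \in C then deletion C E :|: [set E] else C.

Definition simplicial_order d C (s : seq {set 'I_n}) : Prop :=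
  (forall i, i < size s ->
     let Ci := foldl wr_deletion C (take i s) in
     let Ei := nth set0 s i in
     simplicial_face d Ci Ei /\ ~ facet Ci Ei)
  /\ foldl wr_deletion C s = complete_skeleton d.

Definition d_chordal d C : Prop :=
  d_closure d C = complete_skeleton d
  \/ exists s, simplicial_order d (d_closure d C) s.

Definition chordal C : Prop := forall d, 0 < d -> d_chordal d C.

Definition elementary_collapse d C C' : Prop :=
  exists E, [/\ free_face C E, #|E| <= d & C' = deletion C E].

Definition d_collapsible d C : Prop :=
  clos_refl_trans_1n _ (elementary_collapse d) C set0.

End Complexes.

(* Main.v *)
Require Import Defs.
From mathcomp Require Import all_boot.
From Stdlib Require Import Relation_Operators.

(** A simplicial order and a [d]-collapse of a [d]-closure are the same process
    seen with and without the faces of cardinal at most [d].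

    Write [fill d C] for the union of a complex [C] with the complete skeleton of
    all sets of at most [d] elements.  If [E] is a face of [C] with [d] elements,
    filling turns deletion into the operation that keeps [E]: filling
    [deletion C E] is the same as applying [wr_deletion] at [E] to [fill d C]
    (lemma [wr_deletion_fill]), because the only set of at most [d] elements
    that contains [E] is [E] itself.  For the same reason, being simplicial and
    not a facet in [fill d C] amounts, for such an [E], to being free in [C] and
    contained in a larger face of [C].

    A simplicial order therefore lifts, step by step, to elementary
    [d]-collapses of any complex whose filling is the given one
    ([simplicial_order_collapsible]).  The remaining complex has only faces of
    at most [d] elements, and these can be removed one facet at a time.

    Conversely, consider a collapse at [E] whose unique facet is [F].  If [F] has
    at most [d] elements, the collapse is invisible after filling.  If [E] has
    exactly [d] elements and [F] has more, it is one step of a simplicial order.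
    If [E] has fewer than [d] elements and [F] more than [d], choose [v] in [F]
    but not in [E]: deleting [E] amounts to deleting first [v |: E], whose unique
    facet is [F], and then [E], whose unique facet has become [F :\ v].  In both
    collapses the facet exceeds the deleted face by one element less, so
    induction on the difference concludes ([free_collapse_order]).

    Since a [d]-closure contains the complete skeleton, it is its own filling;
    and since taking [d]-closures is idempotent, the statement about chordality
    is the first one applied to the [d]-closures of the complex. *)

Set Implicit Arguments.
Unset Strict Implicit.
Unset Printing Implicit Defensive.

Section Collapsing.

Variable n : nat.
Implicit Types (d : nat) (E F G : {set 'I_n}) (C : {set {set 'I_n}}).

(** * Free faces and deletions *)

Lemma exists_facet C F : F \in C -> exists2 G, facet C G & F \subset G.
Proof. by move=> FC; have [G] := @maxset_exists _ [pred G | G \in C] F FC; exists G. Qed.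

Lemma facet_in C F : facet C F -> F \in C.
Proof. by case/maxsetP. Qed.

(** Replaces uniqueness of a facet by the existence of a greatest face, a
    condition that passes to any smaller complex containing that face. *)
Lemma free_faceP C E :
  free_face C E <->
  E \in C /\ exists F, [/\ F \in C, E \subset F &
                        forall G, G \in C -> E \subset G -> G \subset F].
Proof.
split=> [[EC [F [[facF EF] uniqF]]] | [EC [F [FC EF maxF]]]]; split=> //.
  exists F; split=> // [|G GC EG]; first exact: facet_in.
  have [H facH GH] := exists_facet GC.
  by rewrite (uniqF H) //; split=> //; apply: subset_trans GH.
exists F; split=> [|G [/maxsetP[GC maxG] EG]].
  split=> //; apply/maxsetP; split=> // G GC FG; apply/eqP.
  by rewrite eqEsubset FG maxF //; apply: subset_trans FG.
by apply: maxG; rewrite ?maxF.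
Qed.

Lemma facet_free C F : facet C F -> free_face C F.
Proof.
move=> facF; have [FC maxF] := maxsetP facF.
apply/free_faceP; split=> //; exists F; split=> // G GC FG.
by rewrite (maxF G).
Qed.

Lemma deletion_complex C E :
  simplicial_complex C -> simplicial_complex (deletion C E).
Proof.
move=> cxC F G; rewrite !inE => /andP[FC nEF] GF.
rewrite (cxC F) //=; apply: contra nEF => EG; exact: subset_trans GF.
Qed.

(** Facets are free, and here all have at most [d] elements, so removing them
    one by one is a sequence of elementary collapses. *)
Lemma skeleton_collapsible d C :
  simplicial_complex C -> C \subset complete_skeleton n d -> d_collapsible d C.
Proof.
have [m] := ubnP #|C|; elim: m C => // m IHm C ltCm cxC Csk.
have [-> | [G GC]] := set_0Vmem C; first exact: rt1n_refl.
have [E facE _] := exists_facet GC; have EC := facet_in facE.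
apply: (@rt1n_trans _ _ _ (deletion C E)).
  exists E; split=> //; first exact: facet_free.
  by move/subsetP/(_ E EC): Csk; rewrite inE.
have delC : deletion C E \subset C by apply/subsetP => F; rewrite inE => /andP[].
apply: IHm; [|exact: deletion_complex|exact: subset_trans Csk].
apply: leq_trans (ltCm : #|C| <= m); apply: proper_card.
apply/properP; split=> //; exists E => //.
by rewrite inE EC subxx.
Qed.

(** * Filling in the small faces *)

Definition fill d C := C :|: complete_skeleton n d.

Lemma in_fill d C F : (F \in fill d C) = (F \in C) || (#|F| <= d).
Proof. by rewrite !inE. Qed.

Lemma subset_small d E F : #|E| = d -> #|F| <= d -> (E \subset F) = (F == E).
Proof.
by move=> cardE cardF; rewrite [F == E]eq_sym eqEcard cardE cardF andbT.
Qed.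

(** Filling restores exactly the face [E] that [wr_deletion] keeps. *)
Lemma wr_deletion_fill d C E :
  #|E| = d -> wr_deletion (fill d C) E = fill d (deletion C E).
Proof.
move=> cardE; have Efill : E \in fill d C by rewrite in_fill cardE leqnn orbT.
apply/setP => F; rewrite /wr_deletion Efill in_fill !inE.
case: (leqP #|F| d) => [leFd | ltdF].
  by rewrite (subset_small cardE leFd) !orbT /= orNb.
have /negPf-> : F != E by apply: contraTneq ltdF => ->; rewrite cardE ltnn.
by rewrite !orbF.
Qed.

Lemma simplicial_fill_free d C E :
  simplicial_complex C -> simplicial_face d (fill d C) E ->
  ~ facet (fill d C) E -> free_face C E.
Proof.
move=> cxC [/free_faceP[Efill [F [Ffill EF maxF]]] cardE] nfacE.
(* The greatest face above E is larger than E, so it is not a filled-in face. *)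
have FC : F \in C.
  move: Ffill; rewrite in_fill => /orP[// | leFd].
  move: EF; rewrite (subset_small cardE leFd) => /eqP eqFE.
  case: nfacE; apply/maxsetP; split=> // G Gfill EG.
  by apply/eqP; rewrite eqEsubset EG -eqFE maxF.
apply/free_faceP; split; first exact: cxC EF.
by exists F; split=> // G GC; apply: maxF; rewrite in_fill GC.
Qed.

Lemma free_simplicial_fill d C E F :
  #|E| = d -> d < #|F| -> F \in C -> E \subset F ->
  (forall G, G \in C -> E \subset G -> G \subset F) ->
  simplicial_face d (fill d C) E /\ ~ facet (fill d C) E.
Proof.
move=> cardE ltdF FC EF maxF; split; last first.
  move/maxsetP=> [_ maxE]; have eqFE : F = E by apply: maxE; rewrite //= in_fill FC.
  by rewrite eqFE cardE ltnn in ltdF.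
split=> //; apply/free_faceP; split; first by rewrite in_fill cardE leqnn orbT.
exists F; split=> // [|G]; first by rewrite in_fill FC.
rewrite in_fill => /orP[GC | leGd]; first exact: maxF.
by rewrite (subset_small cardE leGd) => /eqP->.
Qed.

(** * From simplicial orders to collapses *)

Lemma simplicial_order_cons d C E s :
  simplicial_order d C (E :: s) <->
  (simplicial_face d C E /\ ~ facet C E) /\ simplicial_order d (wr_deletion C E) s.
Proof.
split=> [[step fin] | [stepE [step fin]]].
  split; first exact: (step 0).
  by split=> // i lti; apply: (step i.+1).
by split=> // -[_ | i lti]; [rewrite take0 | apply: step].
Qed.

Lemma simplicial_order_collapsible d C s :
  simplicial_complex C -> simplicial_order d (fill d C) s -> d_collapsible d C.
Proof.
elim: s C => [|E s IHs] C cxC.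
  case=> _ /= fillC; apply: skeleton_collapsible => //.
  by rewrite -fillC subsetUl.
case/simplicial_order_cons=> -[simE nfacE].
have [_ cardE] := simE; rewrite (wr_deletion_fill C cardE) => ordE.
apply: (@rt1n_trans _ _ _ (deletion C E)).
  exists E; split=> //; last by rewrite cardE.
  exact: simplicial_fill_free nfacE.
by apply: IHs => //; apply: deletion_complex.
Qed.

(** * From collapses to simplicial orders *)

Definition has_simplicial_order d C := exists s, simplicial_order d C s.

(** A collapse at a face of fewer than [d] elements is traded for collapses at
    larger faces, until these have [d] elements or only small faces vanish. *)
Lemma free_collapse_order d C E F :
  simplicial_complex C -> #|E| <= d -> F \in C -> E \subset F ->
  (forall G, G \in C -> E \subset G -> G \subset F) ->
  has_simplicial_order d (fill d (deletion C E)) ->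
  has_simplicial_order d (fill d C).
Proof.
have [m] := ubnP #|F :\: E|.
elim: m C E F => // m IHm C E F ltm cxC leEd FC EF maxF ordCE.
have [leFd | ltdF] := leqP #|F| d.
  suff -> : fill d C = fill d (deletion C E) by [].
  apply/setP => G; rewrite !in_fill inE.
  have [GC /= | //] := boolP (G \in C).
  have [EG | //] := boolP (E \subset G).
  by rewrite (leq_trans (subset_leq_card (maxF G GC EG)) leFd).
case: (ltngtP #|E| d) leEd => // [ltEd | cardE] _; last first.
  case: ordCE => s ords; exists (E :: s); apply/simplicial_order_cons.
  by rewrite (wr_deletion_fill C cardE); split=> //; apply: free_simplicial_fill maxF.
have [v vF nvE] : exists2 v, v \in F & v \notin E.
  apply/subsetPn; apply: contraTN ltdF => /subset_leq_card leFE.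
  by rewrite -leqNgt (leq_trans leFE (ltnW ltEd)).
(* Once [v |: E] is gone, the greatest face above [E] shrinks to [F :\ v]. *)
have del_del : deletion (deletion C (v |: E)) E = deletion C E.
  apply/setP => G; rewrite !inE subUset sub1set negb_and -andbA.
  by case: (E \subset G) => //=; rewrite ?andbF ?orbT.
have vFE : v \in F :\: E by rewrite inE nvE.
have ltFE : #|(F :\: E) :\ v| < m.
  by move: ltm; rewrite (cardsD1 v) vFE.
apply: (IHm C (v |: E) F) => //.
- by rewrite setUC -setDDl.
- by rewrite cardsU1 nvE.
- by rewrite subUset sub1set vF.
- by move=> G GC vEG; apply: maxF => //; apply: subset_trans (subsetUr _ _) vEG.
apply: (IHm _ E (F :\ v)); rewrite ?del_del //.
- by rewrite setDDl setUC -setDDl.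
- exact: deletion_complex.
- exact: ltnW.
- rewrite inE (cxC F) ?subsetDl //= subUset sub1set.
  by rewrite !inE eqxx.
- by rewrite subsetD1 EF.
move=> G; rewrite inE subUset sub1set => /andP[GC nvEG] EG.
rewrite EG andbT in nvEG.
by rewrite subsetD1 nvEG maxF.
Qed.

Lemma collapsible_order d C :
  simplicial_complex C -> d_collapsible d C -> has_simplicial_order d (fill d C).
Proof.
move=> cxC collC; suff: has_simplicial_order d (fill d set0).
  elim: {C} collC cxC => // C C' D [E [freeE leEd ->]] _ IH cxC ordD.
  have [_ [F [FC EF maxF]]] := (free_faceP C E).1 freeE.
  apply: (free_collapse_order cxC leEd FC EF maxF).
  by apply: IH => //; apply: deletion_complex.
by exists [::]; split=> //=; rewrite /fill set0U.
Qed.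

(** * Closures *)

(** The three clauses of the closure merge into one: a set of at most [d]
    elements has no subset of [d.+1] elements, and a set of [d.+1] elements has
    only itself. *)
Lemma in_d_closure d C F :
  reflect (forall G, G \subset F -> #|G| = d.+1 -> G \in C) (F \in d_closure d C).
Proof.
rewrite inE; case: (ltngtP #|F| d.+1) => [ltFd | ltdF | cardF].
- rewrite -ltnS ltFd; constructor=> G /subset_leq_card leGF cardG.
  by rewrite cardG leqNgt ltFd in leGF.
- rewrite leqNgt (ltnW ltdF) /=; apply: (iffP forallP) => [clF G GF cardG | clF G].
    by have /implyP := clF G; apply; rewrite GF cardG eqxx.
  by apply/implyP => /andP[GF /eqP]; apply: clF.
rewrite cardF ltnn /= orbF; apply: (iffP idP) => [FC G GF cardG | ].
  suff -> : G = F by [].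
  by apply/eqP; rewrite eqEcard GF cardF cardG leqnn.
exact.
Qed.

Lemma d_closure_complex d C : simplicial_complex (d_closure d C).
Proof.
move=> F G /in_d_closure clF GF; apply/in_d_closure => H HG.
by apply: clF; apply: subset_trans GF.
Qed.

Lemma d_closureK d C : d_closure d (d_closure d C) = d_closure d C.
Proof.
apply/setP => F; apply/in_d_closure/in_d_closure => clF G GF cardG.
  by have /in_d_closure := clF G GF cardG; apply.
by apply/in_d_closure => H HG; apply: clF; apply: subset_trans GF.
Qed.

Lemma fill_d_closure d C : fill d (d_closure d C) = d_closure d C.
Proof.
apply/setP => F; rewrite in_fill orbC; case: leqP => //= leFd.
by rewrite inE leFd.
Qed.

(** The complete skeleton has the empty simplicial order. *)
Lemma d_chordalP d C : d_chordal d C <-> has_simplicial_order d (d_closure d C).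
Proof. by split; [case=> // skel; exists [::] | right]. Qed.

Lemma d_chordal_collapsible d C :
  d_chordal d C <-> d_collapsible d (d_closure d C).
Proof.
have cxC := @d_closure_complex d C.
split=> [/d_chordalP[s] | collC].
  by rewrite -{1}fill_d_closure; apply: simplicial_order_collapsible.
by apply/d_chordalP; rewrite -fill_d_closure; apply: collapsible_order.
Qed.

End Collapsing.

Theorem theorem3p4 (n : nat) :
  (forall (d : nat) (C : {set {set 'I_n}}),
     0 < d -> simplicial_complex C -> is_d_closure d C ->
     (d_chordal d C <-> d_collapsible d C))
  /\
  (forall D : {set {set 'I_n}}, simplicial_complex D ->
     (chordal D <-> forall d : nat, 0 < d -> d_collapsible d (d_closure d D))).
Proof.
split=> [d C _ _ [D _ ->] | D _].
  by rewrite -{2}d_closureK; apply: d_chordal_collapsible.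
by split=> chD d d_gt0; apply/d_chordal_collapsible; apply: chD.
Qed.
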